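(* Let $i,j\ge2$, and let $S_i$ and $S_j$ be periodic locating-dominating sets of $H_i$ and $H_j$ with patterns of even periods $p$ and $q$, respectively. Let $t=\mathrm{lcm}(p,q)$. Let $a,b$ be any integers with $a$ even and $b\equiv i\pmod 2$, and let $$S^*=\{(r,c+a):(r,c)\in S_i\}\ \cup\ \{(i+r,c+b):(r,c)\in S_j\}\subseteq V(H_{i+j}),$$ that is, $S^*=S_i^*\oplus S_j^*$ is obtained by placing a copy of $S_i$ on the first $i$ rows of $H_{i+j}$ and a copy of $S_j$ on the subsequent $j$ rows. Then $S^*$ is a periodic locating-dominating set of $H_{i+j}$ with a pattern of period $t$ (consisting of $t$ consecutive columns of the copy of $S_i$ placed above the corresponding $t$ consecutive columns of the copy of $S_j$), and its density is $$d(S^*,H_{i+j})=\frac{i\cdot d(S_i,H_i)+j\cdot d(S_j,H_j)}{i+j}.$$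
   Context: **Grid.** $H_k$ is the graph with vertex set $[k]\times\mathbb Z$, $[k]=\{1,\dots,k\}$ (first coordinate = row, second coordinate = column). Its edges are $\{(r,c),(r,c+1)\}$ for all $r\in[k]$, $c\in\mathbb Z$, and $\{(r,c),(r+1,c)\}$ for all $1\le r<k$ and $c\in\mathbb Z$ with $r+c$ even. The parity conditions on the shifts $a$ and $b$ are exactly those under which $(r,c)\mapsto(r,c+a)$ and $(r,c)\mapsto(i+r,c+b)$ are isomorphisms from $H_i$ and $H_j$ onto the subgraphs of $H_{i+j}$ induced by rows $1,\dots,i$ and by rows $i+1,\dots,i+j$, respectively; the freedom in $a,b$ reflects that the combined patterns may be taken from any $t$ consecutive columns of $S_i$ and $S_j$. **Locating-dominating sets.** For a graph $G=(V,E)$, $N(v)$ is the set of neighbors of $v$. A set $S\subseteq V$ is a locating-dominating set (LDS) if $N(v)\cap S\ne\emptyset$ for every $v\in V\setminus S$, and $N(u)\cap S\ne N(v)\cap S$ for all distinct $u,v\in V\setminus S$. **Density.** For an integer $n\ge1$, $N_n(v)=\{u\in V: 0<\mathrm{dist}(u,v)\le n\}$. For $S\subseteq V$, $d_v(S,G)=\limsup_{n\to\infty}|N_n(v)\cap S|/|N_n(v)|$ and $d(S,G)=\inf_{v\in V}d_v(S,G)$ is the density of $S$. **Periodicity.** An LDS $S$ of $H_k$ is periodic with a pattern of period $p\ge1$ if for all $(r,c)$: $(r,c)\in S\iff(r,c+p)\in S$ (the period $p$ need not be the smallest one). A pattern is the restriction of $S$ to $p$ consecutive columns, and its density is that of the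 periodic solution it defines. *)

(* Defs.v *)
From HB Require Import structures.
From mathcomp Require Import all_boot all_order all_algebra.
From mathcomp Require Import finmap.
From mathcomp Require Import all_classical all_reals all_analysis.

Set Implicit Arguments.
Unset Strict Implicit.
Unset Printing Implicit Defensive.

Import Order.TTheory GRing.Theory Num.Theory.
Local Open Scope classical_set_scope.
Local Open Scope ring_scope.

Section Graph.
Variables (V : choiceType) (e : rel V).
Implicit Types (u v : V) (S : set V).

Definition neighbors v : set V := [set u | e v u].

Definition locating_dominating S : Prop :=
  (forall v, ~ S v -> neighbors v `&` S !=set0) /\
  (forall u v, ~ S u -> ~ S v -> u <> v ->
     neighbors u `&` S <> neighbors v `&` S).

(* [path e u s] is a walk of length [size s]; the distance is +oo between
   vertices in different components. *)
Definition graph_dist (R : realType) u v : \bar R :=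
  ereal_inf [set (size s)%:R%:E | s in [set s | path e u s /\ last u s = v]].

Definition nball (R : realType) (n : nat) v : set V :=
  [set u | (0 < graph_dist R u v <= n%:R%:E)%E].

(* [fset_set A] has the elements of A when A is finite, which is the case of
   [nball R n v] in a locally finite graph. The sequence takes its values in
   [0, 1], so the real-valued [limn_sup] and [inf] are the usual ones. *)
Definition graph_density_at (R : realType) S v : R :=
  limn_sup (fun n : nat =>
    #|` fset_set (nball R n v `&` S)|%:R / #|` fset_set (nball R n v)|%:R).

Definition graph_density (R : realType) S : R :=
  inf (range (graph_density_at R S)).

End Graph.

(* Rows are indexed from 0: the first component [r : 'I_k] of a vertex stands
   for row r + 1. *)
Definition gridV (k : nat) := ('I_k * int)%type.

Definition grid_arc (k : nat) (u v : gridV k) : bool :=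
  (u.1 == v.1) && (v.2 == u.2 + 1) ||
  [&& v.1 == u.1.+1 :> nat, v.2 == u.2 & (2 %| u.1.+1%:Z + u.2)%Z].

Definition grid (k : nat) : rel (gridV k) :=
  fun u v => grid_arc u v || grid_arc v u.

Lemma grid_sym (k : nat) : symmetric (@grid k).
Proof. by move=> u v; rewrite /grid orbC. Qed.

Lemma grid_irr (k : nat) : irreflexive (@grid k).
Proof.
move=> u; rewrite /grid orbb /grid_arc eqxx /=.
rewrite -subr_eq0 opprD addrA subrr add0r oppr_eq0 oner_eq0 /=.
by rewrite (ltn_eqF (ltnSn _)).
Qed.

Definition column_periodic (k p : nat) (S : set (gridV k)) : Prop :=
  (1 <= p)%N /\ forall r c, S (r, c) <-> S (r, c + p%:Z).

(* The pattern formed by the p columns c, ..., c + p - 1. *)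
Definition column_pattern (k p : nat) (c : int) (S : set (gridV k)) :
    set ('I_k * 'I_p) :=
  [set x : 'I_k * 'I_p | S (x.1, c + x.2%:Z)].
Arguments column_pattern [k] p%_N c%_R S%_classical_set_scope _.

Definition shift_columns (k : nat) (a : int) (S : set (gridV k)) :
    set (gridV k) :=
  [set (x.1, x.2 + a) | x in S].

(* The column type C is [int] for sets of vertices and ['I_p] for patterns. *)
Definition stack_rows (C : Type) (i j : nat) (A : set ('I_i * C))
    (B : set ('I_j * C)) : set ('I_(i + j) * C) :=
  [set (lshift j x.1, x.2) | x in A] `|` [set (rshift i x.1, x.2) | x in B].

(* Main.v *)
(* Locating-domination only has to be checked for a vertex u of the upper copy
   against a vertex v of the lower one: if their neighborhoods had the same
   trace on S*, domination inside each copy would close a 4-cycle using two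
   different vertical edges between the rows i and i + 1, whose columns have
   the same parity but are also adjacent.

   In H_k the distance differs from the column distance by at most 3k, so a
   ball of radius n is a block of about 2n columns up to O(1) vertices. A
   p-periodic set with M vertices in p consecutive columns thus has 2nM/p + O(1)
   vertices in the ball; hence its density is M/(kp) at every vertex, and the
   density formula reduces to adding the counts M over t columns. *)
Require Import Defs.
From HB Require Import structures.
From mathcomp Require Import all_boot all_order all_algebra.
From mathcomp Require Import finmap.
From mathcomp Require Import all_classical all_reals all_analysis.
From mathcomp Require Import zify ring lra.

Set Implicit Arguments.
Unset Strict Implicit.
Unset Printing Implicit Defensive.

Import Order.TTheory GRing.Theory Num.Theory.
Import numFieldNormedType.Exports.
Local Open Scope classical_set_scope.
Local Open Scope ring_scope.

(** * Gluing two locating-dominating sets along induced copies *)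

(** Domination, and location inside one copy, are inherited since each copy is induced. Across the
    copies, a common trace contains a dominator [f1 x'] of [f1 x] and a dominator [f2 y'] of [f2 y],
    which yields exactly the two cross edges that [no_square] forbids. *)
Lemma locating_dominating_glue (V1 V2 V : choiceType) (e1 : rel V1)
    (e2 : rel V2) (e : rel V) (f1 : V1 -> V) (f2 : V2 -> V) (S : set V) :
  symmetric e ->
  (forall v, (exists x, v = f1 x) \/ exists y, v = f2 y) ->
  (forall x y, e (f1 x) (f1 y) = e1 x y) ->
  (forall x y, e (f2 x) (f2 y) = e2 x y) ->
  (forall x x' y y', e1 x x' -> e2 y y' ->
     e (f1 x') (f2 y) -> e (f1 x) (f2 y') -> False) ->
  locating_dominating e1 (f1 @^-1` S) -> locating_dominating e2 (f2 @^-1` S) ->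
  locating_dominating e S.
Proof.
move=> e_sym f12 ef1 ef2 no_square [dom1 loc1] [dom2 loc2].
have cross x y : ~ S (f1 x) -> ~ S (f2 y) ->
    neighbors e (f1 x) `&` S <> neighbors e (f2 y) `&` S.
  move=> /dom1[x' [exx' Sx']] /dom2[y' [eyy' Sy']] /seteqP[sub sub'].
  have [ex'y _] : (neighbors e (f2 y) `&` S) (f1 x').
    by apply: sub; split; rewrite //= /neighbors/= ef1.
  have [exy' _] : (neighbors e (f1 x) `&` S) (f2 y').
    by apply: sub'; split; rewrite //= /neighbors/= ef2.
  by apply: (no_square x x' y y') => //; rewrite e_sym.
split.
  move=> v; have [[x ->]|[x ->]] := f12 v.
    by move=> /dom1[y [exy Sy]]; exists (f1 y); split;
      rewrite //= /neighbors/= ef1.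
  by move=> /dom2[y [exy Sy]]; exists (f2 y); split;
    rewrite //= /neighbors/= ef2.
move=> u v; have [[x ->]|[x ->]] := f12 u; have [[y ->]|[y ->]] := f12 v.
- move=> Sx Sy xy /seteqP[sub sub']; apply: (loc1 x y) => //.
    by move=> xy'; apply: xy; rewrite xy'.
  apply/seteqP; split=> z [ez Sz].
    have [] : (neighbors e (f1 y) `&` S) (f1 z).
      by apply: sub; split; rewrite //= /neighbors/= ef1.
    by rewrite /neighbors /= ef1.
  have [] : (neighbors e (f1 x) `&` S) (f1 z).
    by apply: sub'; split; rewrite //= /neighbors/= ef1.
  by rewrite /neighbors /= ef1.
- by move=> Sx Sy _; exact: cross.
- by move=> Sx Sy _ /esym; exact: cross.
- move=> Sx Sy xy /seteqP[sub sub']; apply: (loc2 x y) => //.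
    by move=> xy'; apply: xy; rewrite xy'.
  apply/seteqP; split=> z [ez Sz].
    have [] : (neighbors e (f2 y) `&` S) (f2 z).
      by apply: sub; split; rewrite //= /neighbors/= ef2.
    by rewrite /neighbors /= ef2.
  have [] : (neighbors e (f2 x) `&` S) (f2 z).
    by apply: sub'; split; rewrite //= /neighbors/= ef2.
  by rewrite /neighbors /= ef2.
Qed.

(** * Membership and periodicity under stacking and shifting *)

Lemma stack_rowsl (C : Type) (i j : nat) (A : set ('I_i * C))
    (B : set ('I_j * C)) (r : 'I_i) (c : C) :
  stack_rows A B (lshift j r, c) <-> A (r, c).
Proof.
split=> [[[[s d] /= As [/val_inj/= <- <-]]|[[s d] /= _ [rs _]]]|Arc] //.
- by move: (ltn_ord r); rewrite -rs ltnNge leq_addr.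
- by left; exists (r, c).
Qed.

Lemma stack_rowsr (C : Type) (i j : nat) (A : set ('I_i * C))
    (B : set ('I_j * C)) (r : 'I_j) (c : C) :
  stack_rows A B (rshift i r, c) <-> B (r, c).
Proof.
split=> [[[[s d] /= _ [rs _]]|[[s d] /= Bs [/addnI/val_inj <- <-]]]|Brc] //.
- by move: (ltn_ord s); rewrite rs ltnNge leq_addr.
- by right; exists (r, c).
Qed.

Lemma shift_columnsE (k : nat) (a : int) (S : set (gridV k)) r c :
  shift_columns a S (r, c) <-> S (r, c - a).
Proof.
split=> [[[s d] /= Ss [<- <-]]|Src]; first by rewrite addrK.
by exists (r, c - a); rewrite //= subrK.
Qed.

Lemma column_pattern_stack_rows (i j t : nat) (A : set (gridV i))
    (B : set (gridV j)) (c : int) :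
  column_pattern t c (stack_rows A B) =
  stack_rows (column_pattern t c A) (column_pattern t c B).
Proof.
apply/seteqP; split=> -[r m]; rewrite /column_pattern/=;
  case: (split_ordP r) => s ->.
- by move=> /stack_rowsl ?; apply/stack_rowsl.
- by move=> /stack_rowsr ?; apply/stack_rowsr.
- by move=> /stack_rowsl ?; apply/stack_rowsl.
- by move=> /stack_rowsr ?; apply/stack_rowsr.
Qed.

Lemma column_periodic_dvdn (k p t : nat) (S : set (gridV k)) :
  (0 < t)%N -> (p %| t)%N -> column_periodic p S -> column_periodic t S.
Proof.
move=> t0 /dvdnP[m tE] [_ Sp]; split=> // r c; rewrite {}tE {t0}.
elim: m c => [|m IHm] c; first by rewrite mul0n addr0.
rewrite mulSn PoszD addrA; apply: iff_trans (IHm _); exact: Sp.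
Qed.

Lemma column_periodic_shift (k p : nat) (a : int) (S : set (gridV k)) :
  column_periodic p S -> column_periodic p (shift_columns a S).
Proof.
move=> [p0 Sp]; split=> // r c.
apply: iff_trans (shift_columnsE a S r c) _.
apply: iff_trans (Sp r _) _.
apply: iff_sym; apply: iff_trans (shift_columnsE a S r _) _.
by rewrite addrAC.
Qed.

Lemma column_periodic_stack (i j p : nat) (A : set (gridV i))
    (B : set (gridV j)) :
  column_periodic p A -> column_periodic p B ->
  column_periodic p (stack_rows A B : set (gridV (i + j))).
Proof.
move=> [p0 Ap] [_ Bp]; split=> // r c; case: (split_ordP r) => s ->.
  apply: iff_trans (stack_rowsl A B s c) _; apply: iff_trans (Ap s c) _.
  exact: iff_sym (stack_rowsl A B s _).
apply: iff_trans (stack_rowsr A B s c) _; apply: iff_trans (Bp s c) _.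
exact: iff_sym (stack_rowsr A B s _).
Qed.

(** * Locating-domination of the stacked set *)

Lemma locating_dominating_stack (i j : nat) (a b : int)
    (Si : set (gridV i)) (Sj : set (gridV j)) :
  (2 %| a)%Z -> (b = i%:Z %[mod 2])%Z ->
  locating_dominating (@grid i) Si -> locating_dominating (@grid j) Sj ->
  locating_dominating (@grid (i + j))
    (stack_rows (shift_columns a Si) (shift_columns b Sj)).
Proof.
move=> a_even b_parity Si_lds Sj_lds.
pose f1 (x : gridV i) : gridV (i + j) := (lshift j x.1, x.2 + a).
pose f2 (x : gridV j) : gridV (i + j) := (rshift i x.1, x.2 + b).
apply: (@locating_dominating_glue _ _ _ (@grid i) (@grid j) _ f1 f2).
- exact: grid_sym.
- move=> [r c]; case: (split_ordP r) => s ->.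
    by left; exists (s, c - a); rewrite /f1 /= subrK.
  by right; exists (s, c - b); rewrite /f2 /= subrK.
(* The parity test of a vertical edge changes by [a] here and by [i + b] for [f2] below; both are
   even. *)
- move=> [r c] [r' c']; rewrite /grid /grid_arc /= -!val_eqE /=.
  apply/idP/idP; lia.
- move=> [r c] [r' c']; rewrite /grid /grid_arc /= -!val_eqE /=.
  apply/idP/idP; lia.
(* Since [r, r' < i], a cross edge can only join the 0-based rows [i - 1] and [i]. Hence [r = r'],
   so [c] and [c'] are consecutive, while both cross edges require [c] and [c'] to have the same
   parity. *)
- move=> [r c] [r' c'] [s d] [s' d'].
  rewrite /grid /grid_arc /= -!val_eqE /=.
  have := ltn_ord r; have := ltn_ord r'; lia.
- suff -> : f1 @^-1` stack_rows (shift_columns a Si) (shift_columns b Sj) = Si.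
    by [].
  apply/seteqP; split=> -[r c].
    by move=> /stack_rowsl /shift_columnsE /=; rewrite addrK.
  by move=> Src; apply/stack_rowsl/shift_columnsE; rewrite addrK.
- suff -> : f2 @^-1` stack_rows (shift_columns a Si) (shift_columns b Sj) = Sj.
    by [].
  apply/seteqP; split=> -[r c].
    by move=> /stack_rowsr /shift_columnsE /=; rewrite addrK.
  by move=> Src; apply/stack_rowsr/shift_columnsE; rewrite addrK.
Qed.

(** * Walks of bounded length and the graph distance *)

Section Walks.
Variables (V : choiceType) (e : rel V).

(** Upper bounds on distances are composed as walks with lengths in [nat]; the infimum in the
    extended reals enters only through [graph_dist_le]. *)
Definition walk_le n u v :=
  exists s, [/\ path e u s, last u s = v & (size s <= n)%N].

Lemma walk_le_trans m n u v w :
  walk_le m u v -> walk_le n v w -> walk_le (m + n) u w.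
Proof.
move=> [s [es <- sm]] [s' [es' <- sn]]; exists (s ++ s').
by rewrite cat_path es es' last_cat size_cat leq_add.
Qed.

Lemma walk_leW m n u v : (m <= n)%N -> walk_le m u v -> walk_le n u v.
Proof.
by move=> mn [s [es <- sm]]; exists s; split=> //; apply: leq_trans mn.
Qed.

Lemma walk_le0 u : walk_le 0 u u.
Proof. by exists [::]. Qed.

Lemma walk_le1 u v : e u v -> walk_le 1 u v.
Proof. by move=> uv; exists [:: v]; rewrite /= uv. Qed.

Lemma walk_le_sym n u v : symmetric e -> walk_le n u v -> walk_le n v u.
Proof.
move=> e_sym [s [es <- sn]]; apply: (walk_leW sn) => {sn}.
elim: s u es => [|w s IHs] u /=; first by move=> _; exact: walk_le0.
case/andP=> uw ws; rewrite -addn1.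
by apply: walk_le_trans (IHs _ ws) (walk_le1 _); rewrite e_sym.
Qed.

Lemma graph_dist_le (R : realType) n u v :
  walk_le n u v -> (graph_dist e R u v <= n%:R%:E)%E.
Proof.
move=> [s [es sv sn]]; apply: ge_ereal_inf; exists (size s)%:R%:E.
  by exists s.
by rewrite lee_fin ler_nat.
Qed.

Lemma graph_dist_ge (R : realType) n u v :
  (forall s, path e u s -> last u s = v -> (n <= size s)%N) ->
  (n%:R%:E <= graph_dist e R u v)%E.
Proof.
move=> nP; apply: le_ereal_inf_tmp => _ [s [es sv] <-].
by rewrite lee_fin ler_nat; exact: nP.
Qed.

End Walks.

(** * Distance versus column distance in the grid *)

Lemma grid_walk_row (k : nat) (r : 'I_k) (c d : int) :
  walk_le (@grid k) `|d - c|%N (r, c) (r, d).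
Proof.
wlog le_cd : c d / (c <= d)%R.
  move=> wl; have [/wl//|/ltW/wl w] := lerP c d.
  by rewrite -abszN opprB; apply: walk_le_sym w; exact: grid_sym.
have [n ->] : exists n : nat, d = c + n%:Z by exists `|d - c|%N; lia.
rewrite addrAC subrr add0r absz_nat {le_cd d}.
elim: n => [|n IHn]; first by rewrite addr0; exact: walk_le0.
rewrite -[in walk_le _ _]addn1; apply: walk_le_trans IHn (walk_le1 _).
rewrite /grid /grid_arc /= eqxx /=; lia.
Qed.

(** An edge changes the column by at most one. *)
Lemma grid_path_columns (k : nat) (u : gridV k) (s : seq (gridV k)) :
  path (@grid k) u s -> (`|(last u s).2 - u.2| <= size s)%N.
Proof.
elim: s u => [|w s IHs] u /=; first by rewrite subrr.
case/andP=> uw /IHs; move: uw; rewrite /grid /grid_arc.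
case: u w => [r c] [r' c'] /=; lia.
Qed.

(** The factor 3 pays, for each row, for a step sideways, a vertical edge and the step back. *)
Lemma grid_walk_col (k n : nat) (r s : 'I_k) (c : int) :
  s = (r + n)%N :> nat -> walk_le (@grid k) (3 * n) (r, c) (s, c).
Proof.
elim: n s => [|n IHn] s rs.
  by rewrite (_ : s = r); [exact: walk_le0|apply: val_inj; rewrite /= rs addn0].
have ltk : (r + n < k)%N by have := ltn_ord s; lia.
rewrite mulnS addnC; apply: walk_le_trans (IHn (Ordinal ltk) erefl) _.
(* A vertical edge missing in column c is present in column c + 1. *)
have [even|odd] := boolP (2 %| (r + n).+1%:Z + c)%Z.
  apply: walk_leW (walk_le1 _) => //.
  rewrite /grid /grid_arc /= -!val_eqE /=; lia.
have step d : `|d - c|%N = 1%N ->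
    forall t : 'I_k, walk_le (@grid k) 1 (t, c) (t, d).
  by move=> cd t; rewrite -cd; exact: grid_walk_row.
apply: (@walk_le_trans _ _ 1 2) (step (c + 1) _ _) _; first lia.
apply: (@walk_le_trans _ _ 1 1 _ (s, c + 1)).
  apply: walk_le1; rewrite /grid /grid_arc /= -!val_eqE /=; lia.
by apply: walk_le_sym (step _ _ _); [exact: grid_sym|lia].
Qed.

Lemma grid_walk (k : nat) (u v : gridV k) :
  walk_le (@grid k) (3 * k + `|v.2 - u.2|) u v.
Proof.
case: u v => [r c] [s d] /=.
apply: walk_le_trans (grid_walk_row s c d).
have [rs|sr] := leqP r s.
  apply: walk_leW (@grid_walk_col k (s - r) r s c _); have := ltn_ord s; lia.
apply: walk_le_sym; first exact: grid_sym.
apply: walk_leW (@grid_walk_col k (r - s) s r c _); have := ltn_ord r; lia.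
Qed.

Lemma nball_grid_columns (R : realType) (k n : nat) (v : gridV k) :
  nball (@grid k) R n v `<=` [set u | (`|u.2 - v.2| <= n)%N].
Proof.
move=> u /andP[_ uv] /=.
rewrite -(@ler_nat R) -lee_fin; apply: le_trans uv.
apply: graph_dist_ge => s /grid_path_columns + <-; rewrite -abszN opprB; exact.
Qed.

Lemma columns_nball_grid (R : realType) (k n : nat) (u v : gridV k) :
  u <> v -> (`|u.2 - v.2| + 3 * k <= n)%N -> nball (@grid k) R n v u.
Proof.
move=> uv le_n; apply/andP; split.
  apply: (@lt_le_trans _ _ 1%:R%:E); first by rewrite lte_fin.
  (* Only the empty walk is shorter than 1, and it would force [u = v]. *)
  by apply: graph_dist_ge => -[|//] _ /uv.
by apply/graph_dist_le/walk_leW/grid_walk; rewrite -abszN opprB addnC.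
Qed.

(** * Counting the vertices of a set in consecutive columns *)

(** A sum of truth values, so that splitting, shifting and stacking become manipulations of sums;
    [card_columnsI] identifies it with a cardinality. *)
Definition column_count (k : nat) (S : set (gridV k)) (x : int) (L : nat) :=
  (\sum_(l < L) \sum_(r < k) `[< S (r, (x + l%:Z)%R) >])%N.

Section ColumnCount.
Variable k : nat.
Implicit Types (S : set (gridV k)) (x : int) (L p : nat).

Lemma column_countD S x L1 L2 : column_count S x (L1 + L2) =
  (column_count S x L1 + column_count S (x + L1%:Z) L2)%N.
Proof.
rewrite /column_count big_split_ord /=; congr addn.
by apply: eq_bigr => l _; apply: eq_bigr => r _; rewrite PoszD addrA.
Qed.

Lemma column_count_le S x L : (column_count S x L <= k * L)%N.
Proof.
rewrite -[leqRHS]mulnC -[L in leqRHS]card_ord -sum_nat_const.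
apply: leq_sum => l _; rewrite -[leqRHS]card_ord -sum1_card.
by apply: leq_sum => r _; exact: leq_b1.
Qed.

Lemma column_count_setT x L :
  column_count (setT : set (gridV k)) x L = (k * L)%N.
Proof.
rewrite /column_count (eq_bigr (fun=> k)) ?sum_nat_const ?card_ord 1?mulnC//.
by move=> l _; rewrite -[RHS]card_ord -sum1_card;
  apply: eq_bigr => r _; rewrite asboolT.
Qed.

Lemma column_count_shift a S x L :
  column_count (shift_columns a S) x L = column_count S (x - a) L.
Proof.
apply: eq_bigr => l _; apply: eq_bigr => r _.
by rewrite (asbool_equiv_eq (shift_columnsE _ _ _ _)) addrAC.
Qed.

Section Periodic.
Variables (p : nat) (S : set (gridV k)).
Hypothesis S_per : column_periodic p S.

Lemma column_count_periodic x L :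
  column_count S (x + p%:Z) L = column_count S x L.
Proof.
apply: eq_bigr => l _; apply: eq_bigr => r _.
by rewrite addrAC -(asbool_equiv_eq (S_per.2 _ _)).
Qed.

(** Sliding the window by one column drops column [y] and gains column [y + p], which has the same
    count: the [p + 1] columns from [y] are split in two ways. *)
Lemma column_count_period x : column_count S x p = column_count S 0 p.
Proof.
have step y : column_count S (y + 1) p = column_count S y p.
  have := column_countD S y p 1; rewrite column_count_periodic.
  by rewrite (addnC p) column_countD addnC => /addIn.
elim/int_ind: x => // n <-; first by rewrite -addn1 PoszD step.
by rewrite -step -addn1 PoszD opprD subrK.
Qed.

Lemma column_count_periods x m :
  column_count S x (m * p) = (m * column_count S 0 p)%N.
Proof.
elim: m x => [|m IHm] x; first by rewrite /column_count big_ord0.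
by rewrite !mulSn column_countD column_count_period IHm.
Qed.

(** Write [L = m * p + s] with [s < p], and [M] for the count over one period. The full periods
    contribute exactly [m * M] and the last [s] columns at most [k * s]. Multiplying by [p] keeps
    everything in [nat]; the errors [s * M] and [p * k * s] are at most [k * p * p]. *)
Lemma column_count_bounds x L :
  (p * column_count S x L <= L * column_count S 0 p + k * p * p)%N /\
  (L * column_count S 0 p <= p * column_count S x L + k * p * p)%N.
Proof.
have ltp : (L %% p < p)%N by rewrite ltn_mod S_per.1.
rewrite (divn_eq L p); move: (L %/ p)%N (L %% p)%N ltp => m s ltp.
rewrite column_countD column_count_periods.
have MP := column_count_le S 0 p.
have FP := column_count_le S (x + (m * p)%N%:Z) s.
move: (leq_mul (ltnW ltp) MP) (leq_mul (leqnn p) FP).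
move: (leq_mul (leqnn (p * k)%N) (ltnW ltp)); nia.
Qed.

End Periodic.
End ColumnCount.

Lemma column_count_stack (i j : nat) (A : set (gridV i))
    (B : set (gridV j)) x L :
  column_count (stack_rows A B : set (gridV (i + j))) x L =
  (column_count A x L + column_count B x L)%N.
Proof.
rewrite /column_count -big_split; apply: eq_bigr => l _ /=.
rewrite big_split_ord; congr addn; apply: eq_bigr => r _; congr nat_of_bool.
  by rewrite (asbool_equiv_eq (stack_rowsl _ _ _ _)).
by rewrite (asbool_equiv_eq (stack_rowsr _ _ _ _)).
Qed.

(** * Blocks of columns as finite sets, and counts in balls *)

Definition columns (k : nat) (x : int) (L : nat) : set (gridV k) :=
  [set u | x <= u.2 < x + L%:Z].
Arguments columns : clear implicits.

(** Parametrizing by row and column offset gives both finiteness and, by injectivity, the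
    cardinality. *)
Lemma columnsIE (k : nat) (x : int) (L : nat) (S : set (gridV k)) :
  columns k x L `&` S =
  [set` [fset (y.1, (x + y.2%:Z)%R) | y : 'I_k * 'I_L in
     [pred y : 'I_k * 'I_L | `[< S (y.1, (x + y.2%:Z)%R) >]]]%fset].
Proof.
apply/seteqP; split=> [[r c] [/= cL Src]|_ /imfsetP[[r l] /= /asboolP Srl ->]].
  have lL : (`|c - x| < L)%N by move: cL; rewrite /columns /=; lia.
  have cE : c = x + `|c - x|%N by move: cL; rewrite /columns /=; lia.
  rewrite /=; apply/imfsetP; exists (r, Ordinal lL); rewrite /= -?cE//.
  by apply/asboolP; rewrite /= -cE.
by split=> //=; rewrite /columns/=; have := ltn_ord l; lia.
Qed.

Lemma finite_columnsI (k : nat) (x : int) (L : nat) (S : set (gridV k)) :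
  finite_set (columns k x L `&` S).
Proof. by rewrite columnsIE; exact: finite_fset. Qed.

Lemma card_columnsI (k : nat) (x : int) (L : nat) (S : set (gridV k)) :
  #|` fset_set (columns k x L `&` S)| = column_count S x L.
Proof.
rewrite columnsIE set_fsetK card_imfset; last first.
  by move=> [r l] [s m] [-> /addrI[/val_inj ->]].
rewrite -cardE -sum1_card /column_count exchange_big pair_big_dep /=.
rewrite big_mkcond; apply: eq_bigr => -[r l] _ /=.
by rewrite unfold_in /=; case: asbool.
Qed.

Section BallCount.
Variables (R : realType) (k p : nat) (S : set (gridV k)).
Hypothesis S_per : column_periodic p S.
Let M := column_count S 0 p.
Let ball_count v n := #|` fset_set (nball (@grid k) R n v `&` S)|.

(** The ball lies in a block of [2 * n + 1] columns and contains, up to its center, a block of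
    [2 * m] columns with [m = n - 3 * k]. *)
Lemma ball_count_bounds v : exists C, forall n,
  (p * ball_count v n <= 2 * n * M + C)%N /\
  (2 * n * M <= p * ball_count v n + C)%N.
Proof.
(* [M] comes from the extra column of the outer block, [k * p * p] from incomplete periods, [p] from
   the center, and [6 * k * M] from replacing [2 * m] by [2 * n]. *)
exists (M + k * p * p + p + 6 * k * M)%N => n; set A := ball_count v n.
(* Truncated subtraction: for [n < 3 * k] the inner block is empty, and [n <= m + 3 * k] always
   holds. *)
set m := (n - 3 * k)%N.
have ball_sub : nball (@grid k) R n v `&` S `<=`
    columns k (v.2 - n%:Z) (2 * n + 1) `&` S.
  move=> u [/nball_grid_columns /= uv Su]; split=> //.
  by rewrite /columns /=; lia.
have ball_fin : finite_set (nball (@grid k) R n v `&` S).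
  exact: sub_finite_set ball_sub (finite_columnsI _ _ _).
(* The center is added because [nball] excludes it. *)
have sub_ball : columns k (v.2 - m%:Z) (2 * m) `&` S `<=`
    v |` (nball (@grid k) R n v `&` S).
  move=> u [cu Su]; have [->|/eqP uv] := eqVneq u v; first by left.
  right; split=> //; apply: columns_nball_grid => //.
  by move: cu; rewrite /columns /m /=; lia.
have upper : (A <= column_count S (v.2 - n%:Z) (2 * n + 1))%N.
  rewrite -card_columnsI; apply: fsubset_leq_card.
  by rewrite -fset_set_sub //; exact: finite_columnsI.
have lower : (column_count S (v.2 - m%:Z) (2 * m) <= A + 1)%N.
  have vfin : finite_set (v |` (nball (@grid k) R n v `&` S)).
    by rewrite finite_setU; split=> //; exact: finite_set1.
  rewrite -card_columnsI addnC.
  apply: (@leq_trans #|` fset_set (v |` (nball (@grid k) R n v `&` S))|).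
    apply: fsubset_leq_card; rewrite -fset_set_sub //; exact: finite_columnsI.
  by rewrite fset_setU1 // cardfsU1 leq_add2r leq_b1.
have [_ lo] := column_count_bounds S_per (v.2 - m%:Z) (2 * m).
have [up _] := column_count_bounds S_per (v.2 - n%:Z) (2 * n + 1).
rewrite -/M in lo up.
have := leq_mul (leqnn p) upper; have := leq_mul (leqnn p) lower.
have nm : (n <= m + 3 * k)%N by rewrite /m; lia.
have := leq_mul nm (leqnn M).
split; lia.
Qed.

End BallCount.

(** * Limits of ratios of linearly growing sequences *)

(** Squeeze between [s - C / n.+1] and [s + C / n.+1]; the shifted index avoids division by zero and
    matches [harmonic]. *)
Lemma cvg_linear_growth (R : realType) (u : nat -> R) (s C : R) :
  (forall n, `|u n - s * n%:R| <= C) ->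
  u n.+1 / n.+1%:R @[n --> \oo] --> s.
Proof.
move=> uC.
apply: (@squeeze_cvgr _ _ _ _ (fun n => s - C * harmonic n)
  (fun n => s + C * harmonic n)).
- near=> n; have n0 : 0 < n.+1%:R :> R by rewrite ltr0n.
  have := uC n.+1; rewrite ler_norml => /andP[lo hi].
  have -> : harmonic n = n.+1%:R^-1 :> R by [].
  rewrite ler_pdivlMr // ler_pdivrMr // !mulrDl mulNr -!mulrA.
  rewrite !mulVf ?gt_eqF//; lra.
- rewrite -[X in _ --> X]subr0 -[X in _ - X](mulr0 C).
  by apply: cvgB; [exact: cvg_cst|apply: cvgMr; exact: cvg_harmonic].
- rewrite -[X in _ --> X]addr0 -[X in _ + X](mulr0 C).
  by apply: cvgD; [exact: cvg_cst|apply: cvgMr; exact: cvg_harmonic].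
Unshelve. all: by end_near. Qed.

Lemma cvg_ratio_linear_growth (R : realType) (u w : nat -> R) (s t C D : R) :
  t != 0 -> (forall n, `|u n - s * n%:R| <= C) ->
  (forall n, `|w n - t * n%:R| <= D) ->
  u n / w n @[n --> \oo] --> s / t.
Proof.
move=> t0 /cvg_linear_growth us /cvg_linear_growth wt.
rewrite -(cvg_shiftS (fun n => u n / w n)).
rewrite (_ : [sequence _]_n = (fun n => u n.+1 / n.+1%:R) \*
    (fun n => (w n.+1 / n.+1%:R)^-1)); first exact: cvgM us (cvgV t0 wt).
by apply/funext => n /=; rewrite invf_div mulrA divfK.
Qed.

(** * The density of a periodic set *)

(** Numerator and denominator of the density at [v] both grow linearly in [n], so the upper limit is
    a limit. Its value does not depend on [v], so the infimum is that of a singleton; [0 < k]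
    provides a vertex. *)
Lemma graph_density_periodic (R : realType) (k p : nat) (S : set (gridV k)) :
  (0 < k)%N -> column_periodic p S ->
  graph_density (@grid k) R S = (column_count S 0 p)%:R / (k * p)%:R.
Proof.
move=> k0 S_per; have p0 := S_per.1.
(* The ball itself is counted as its intersection with the full vertex set, which has [k * p]
   vertices per period. *)
have T_per : column_periodic p (setT : set (gridV k)) by [].
have pR : (p%:R : R) != 0 by rewrite pnatr_eq0 -lt0n.
have kR : (k%:R : R) != 0 by rewrite pnatr_eq0 -lt0n.
have growth (T : set (gridV k)) v : column_periodic p T ->
    exists C : R, forall n,
    `|#|` fset_set (nball (@grid k) R n v `&` T)|%:R
      - 2 * (column_count T 0 p)%:R / p%:R * n%:R| <= C.
  (* The bound in [nat] carries a factor [p] on the ball count, hence the constant [C / p]. *)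
  move=> /(@ball_count_bounds R k p T)/(_ v)[C CP]; exists (C%:R / p%:R) => n.
  have [] := CP n; set A := #|` _|.
  rewrite -!(ler_nat R) !natrD !natrM => hi lo.
  rewrite ler_pdivlMr ?ltr0n //.
  rewrite -[X in _ * X <= _](ger0_norm (ler0n R p)) -normrM.
  rewrite mulrBl (mulrAC _ n%:R) divfK // ler_norml; lra.
have at_v v : graph_density_at (@grid k) R S v =
    (column_count S 0 p)%:R / (k * p)%:R.
  have [C CP] := growth S v S_per; have [D DP] := growth setT v T_per.
  rewrite column_count_setT in DP.
  have kp : 2 * (k * p)%:R / p%:R != 0 :> R.
    by rewrite !mulf_neq0 ?invr_eq0 // natrM mulf_neq0.
  have := cvg_ratio_linear_growth kp CP DP => /cvg_limn_inf_sup[_].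
  under eq_fun do rewrite setIT.
  rewrite /graph_density_at => ->; rewrite natrM; field.
  by rewrite pR kR.
rewrite /graph_density
  (_ : range _ = [set (column_count S 0 p)%:R / (k * p)%:R]).
  exact: inf1.
apply/seteqP; split=> [_ [v _ <-]|_ ->]; first exact: at_v.
by exists (Ordinal k0, 0).
Qed.

Theorem theorem5 (R : realType) (i j : nat) (hi : (2 <= i)%N) (hj : (2 <= j)%N)
    (Si : set (gridV i)) (Sj : set (gridV j)) (p q : nat)
    (Si_lds : locating_dominating (@grid i) Si)
    (Sj_lds : locating_dominating (@grid j) Sj)
    (Si_per : column_periodic p Si) (Sj_per : column_periodic q Sj)
    (p_even : ~~ odd p) (q_even : ~~ odd q)
    (a b : int) (a_even : (2 %| a)%Z) (b_parity : (b = i%:Z %[mod 2])%Z) :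
  let t := lcmn p q in
  let Sstar : set (gridV (i + j)) :=
    stack_rows (shift_columns a Si) (shift_columns b Sj) in
  [/\ locating_dominating (@grid (i + j)) Sstar,
      column_periodic t Sstar,
      forall c : int, column_pattern t c Sstar =
        stack_rows (column_pattern t c (shift_columns a Si))
                   (column_pattern t c (shift_columns b Sj)) &
      graph_density (@grid (i + j)) R Sstar =
        (i%:R * graph_density (@grid i) R Si
         + j%:R * graph_density (@grid j) R Sj)
          / (i + j)%:R].
Proof.
move=> t Sstar.
have t0 : (0 < t)%N by rewrite lcmn_gt0 Si_per.1 Sj_per.1.
have Si_t := column_periodic_dvdn t0 (dvdn_lcml p q) Si_per.
have Sj_t := column_periodic_dvdn t0 (dvdn_lcmr p q) Sj_per.
have Sstar_t : column_periodic t Sstar.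
  by apply: column_periodic_stack; exact: column_periodic_shift.
split => //.
- exact: locating_dominating_stack.
- by move=> c; exact: column_pattern_stack_rows.
have i0 : (0 < i)%N := ltnW hi.
have j0 : (0 < j)%N := ltnW hj.
(* All three densities are expressed over the common period [t], where counts add up. The shifts
   move the windows to start at [- a] and [- b], and periodicity brings them back to 0. *)
rewrite (graph_density_periodic R i0 Si_t) (graph_density_periodic R j0 Sj_t).
rewrite (graph_density_periodic R (ltn_addr j i0) Sstar_t).
rewrite column_count_stack !column_count_shift.
rewrite (column_count_period Si_t) (column_count_period Sj_t) !natrM !natrD.
have tR : (t%:R : R) != 0 by rewrite pnatr_eq0 -lt0n.
have iR : (i%:R : R) != 0 by rewrite pnatr_eq0 -lt0n.
have jR : (j%:R : R) != 0 by rewrite pnatr_eq0 -lt0n.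
have ijR : (i%:R + j%:R : R) != 0 by rewrite -natrD pnatr_eq0 -lt0n ltn_addr.
by field; rewrite ijR iR jR tR.
Qed.
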